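(* Let $X_1,X_2,X_3,\dots$ be second countable, locally compact metric spaces, and let $$W=\Big(\prod_{n=1}^{\infty}X_n\Big)\cup\bigcup_{k=1}^{\infty}(X_1\times\cdots\times X_k),\qquad W_0=W\cup\{0\},$$ where $W_0$ carries the quotient topology determined by the map $Q:\prod_{n=1}^\infty X_n^\infty\to W_0$. Then the space $W=W_0\setminus\{0\}$ is a locally compact metric space (i.e. locally compact and metrizable) in the relative topology inherited from the quotient topology of $W_0$.
   Context: The unions are disjoint unions and $0$ is an extra point (the ''empty sequence''). For each $n$, $X_n^\infty=X_n\cup\{\infty_n\}$ is the one-point compactification of $X_n$ (a point $\infty_n$ is always adjoined; it is isolated if $X_n$ is already compact). $A=\prod_{n=1}^\infty X_n^\infty$ has the product topology. The surjection $Q:A\to W_0$ is defined by: $Q(\{x_i\})=\{x_i\}$ if $x_i\neq\infty_i$ for all $i$; $Q(\{x_i\})=(x_1,\dots,x_n)$ if $x_1\ne\infty_1$ and $n\ge1$ is the smallest integer with $x_{n+1}=\infty_{n+1}$; $Q(\{x_i\})=0$ if $x_1=\infty_1$. $W_0$ is given the quotient topology: $U\subset W_0$ is open iff $Q^{-1}(U)$ is open in $A$. *)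

(* Defs.v *)
From HB Require Import structures.
From mathcomp Require Import all_boot all_order all_algebra.
From mathcomp Require Import generic_quotient.
From mathcomp Require Import all_classical all_reals all_analysis.

Set Implicit Arguments.
Unset Strict Implicit.
Unset Printing Implicit Defensive.

Local Open Scope classical_set_scope.
Local Open Scope quotient_scope.
Local Open Scope ring_scope.

(* The spaces X_1, X_2, ... are indexed from 0: [X n] stands for X_{n+1}.
   [fin_seq k x] has length k+1, so [fin_seq] covers every length >= 1. *)
Variant W0 (X : nat -> Type) : Type :=
| inf_seq of (forall n, X n)
| fin_seq k of (forall i : 'I_k.+1, X i)
| zero_seq.

Arguments inf_seq {X} _.
Arguments fin_seq {X} k _.
Arguments zero_seq {X}.

Definition finite_part (T : Type) (o : option T) : isSome o -> T :=
  match o with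
  | Some x => fun=> x
  | None => fun h => False_rect T (notF h)
  end.

Section QuotientMap.
Variable X : nat -> Type.

(* The point at infinity of [one_point_compactification (X n)] is [None]. *)
Local Notation A := (prod_topology (fun n => one_point_compactification (X n))).

Lemma isSome_before (a : A) (h : exists n, ~~ isSome (a n)) (i : 'I_(ex_minn h)) :
  isSome (a i).
Proof.
case: i => i /=; case: ex_minnP => m _ min_m lt_im.
by apply: contraLR lt_im => /min_m; rewrite -leqNgt.
Qed.

Lemma isSome_always (a : A) (h : ~ exists n, ~~ isSome (a n)) n : isSome (a n).
Proof. by apply: contra_notT h => an; exists n. Qed.

Definition truncate (a : A) (m : nat) : (forall i : 'I_m, isSome (a i)) -> W0 X :=
  match m with
  | 0%N => fun=> zero_seq
  | k.+1 => fun h => fin_seq k (fun i => finite_part (h i))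
  end.

(* [ex_minn h] is the least index [n] such that [a n] is the point at infinity;
   because of the indexing from 0, it is also the length of the result. *)
Definition Q (a : A) : W0 X :=
  match pselect (exists n, ~~ isSome (a n)) with
  | left h => truncate (@isSome_before a h)
  | right h => inf_seq (fun n => finite_part (isSome_always h n))
  end.

(* A section of [Q], required by the [quotType] interface: a finite sequence is
   continued with points at infinity. *)
Definition pad (w : W0 X) : A :=
  match w with
  | inf_seq x => fun n => Some (x n)
  | fin_seq k x => fun n =>
      match boolP (n < k.+1)%N with
      | AltTrue lt_nk => Some (x (Ordinal lt_nk))
      | AltFalse _ => None
      end
  | zero_seq => fun=> None
  end.

Lemma finite_partE (T : Type) (o : option T) (x : T) (h : isSome o) :
  o = Some x -> finite_part h = x.
Proof. by move=> e; move: h; rewrite e. Qed.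

Lemma pad_fin k x (i : 'I_k.+1) : pad (fin_seq k x) i = Some (x i).
Proof.
case: i => i lt_ik /=; case: {-}_ / boolP => [lt_ik'|]; last by rewrite lt_ik.
by rewrite (bool_irrelevance lt_ik' lt_ik).
Qed.

Lemma pad_finN k x n : (k < n)%N -> pad (fin_seq k x) n = None.
Proof.
move=> lt_kn /=; case: {-}_ / boolP => // lt_nk.
by exfalso; move: lt_nk; rewrite ltnS leqNgt lt_kn.
Qed.

Lemma truncate_pad k x (h : forall i : 'I_k.+1, isSome (pad (fin_seq k x) i)) :
  truncate h = fin_seq k x.
Proof.
rewrite /truncate; congr fin_seq; apply: functional_extensionality_dep => i.
exact/finite_partE/pad_fin.
Qed.

Lemma padK : cancel pad Q.
Proof.
move=> w; rewrite /Q; case: pselect => [h|h].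
  case: w h => [x|k x|] h; first by exfalso; case: h.
    have Em : ex_minn h = k.+1.
      case: ex_minnP => m hm min_m; apply/eqP; rewrite eqn_leq.
      rewrite min_m ?pad_finN// ltnNge; apply: contraNN hm => le_mk.
      by rewrite (pad_fin x (Ordinal (le_mk : (m < k.+1)%N))).
    by move: (@isSome_before _ h); rewrite Em; exact: truncate_pad.
  have Em : ex_minn h = 0%N.
    by case: ex_minnP => m _ /(_ 0%N isT); rewrite leqn0 => /eqP.
  by move: (@isSome_before _ h); rewrite Em.
case: w h => [x|k x|] h //.
- by exfalso; apply: h; exists k.+1; rewrite pad_finN.
- by exfalso; apply: h; exists 0%N.
Qed.

HB.instance Definition _ := isQuotient.Build A (W0 X) padK.

End QuotientMap.

Definition W0_space (X : nat -> topologicalType) : topologicalType :=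
  quotient_topology (W0 X).

Lemma W0_openE (X : nat -> topologicalType) (U : set (W0_space X)) :
  open U = open (@Q X @^-1` U).
Proof. by rewrite {1}/open /= /quotient_open pi.unlock. Qed.

Definition W (X : nat -> topologicalType) : set (W0_space X) :=
  ~` [set (zero_seq : W0 X)].
Arguments W X : clear implicits.

Definition metrizable (R : realType) (T : topologicalType) : Prop :=
  exists d : T -> T -> R,
    [/\ forall x, d x x = 0,
        forall x y, d x y = 0 -> x = y,
        forall x y, d x y = d y x,
        forall x y z, d x z <= d x y + d y z &
        forall U : set T, open U <->
          forall x, U x -> exists2 e, 0 < e & [set y | d x y < e] `<=` U].

(* Main.v *)
(* W_0 is itself compact and metrizable, and W is open in it. On each X_n, the
   distances to the complements of the relatively compact members of a countable
   basis are functions vanishing at infinity that jointly separate the points of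
   the one-point compactification of X_n. A product h_1(x_1) ... h_k(x_k) of such
   functions vanishes as soon as one of x_1, ..., x_k is infinite, so it is
   constant on the fibers of Q. The countably many products descend to
   continuous functions separating the points of the compact space W_0, and a
   weighted supremum of their differences is a metric for its topology. *)
Require Import Defs.
From mathcomp Require Import all_boot all_order all_algebra.
From mathcomp Require Import all_classical all_reals all_analysis.
From mathcomp Require Import generic_quotient lra.
Import Order.TTheory GRing.Theory Num.Theory numFieldNormedType.Exports.
Local Open Scope classical_set_scope.
Local Open Scope ring_scope.

Set Implicit Arguments.
Unset Strict Implicit.
Unset Printing Implicit Defensive.

(** * Metrizing a compact space by a countable separating family *)

Section separating_family.
Context {R : realType} {T : topologicalType}.
Variable F : nat -> T -> R.
Hypothesis cF : forall n, continuous (F n).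
Hypothesis F_inj : forall x y, (forall n, F n x = F n y) -> x = y.

Lemma separating_hausdorff : hausdorff_space T.
Proof.
move=> p q pq; apply: F_inj => n; apply: (@norm_hausdorff _ R) => A B nA nB.
by have [z [Az Bz]] := pq _ _ (cF nA) (cF nB); exists (F n z).
Qed.

Hypothesis F01 : forall n x, 0 <= F n x <= 1.

(** The terms are combined by a supremum rather than a sum, so weights tending to 0 suffice. *)
Let term x y n : R := `|F n x - F n y| / n.+1%:R.
Let d x y : R := sup (range (term x y)).

Let term_ge0 x y n : 0 <= term x y n.
Proof. by rewrite /term divr_ge0. Qed.

Let term_le x y n : term x y n <= n.+1%:R^-1.
Proof.
rewrite /term ler_pdivrMr// mulVf// ler_norml.
by have := F01 n x; have := F01 n y; lra.
Qed.

Let term_le1 x y n : term x y n <= 1.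
Proof. by rewrite (le_trans (term_le _ _ _))// invf_le1// ler1n. Qed.

Let term_le_d x y n : term x y n <= d x y.
Proof.
by apply: ub_le_sup; [exists 1 => _ [m _ <-]; exact: term_le1 | exists n].
Qed.

Let d_le x y e : (forall n, term x y n <= e) -> d x y <= e.
Proof.
move=> te; apply: ge_sup => [|_ [n _ <-]]; last exact: te.
by exists (term x y 0), 0%N.
Qed.

Let dxx x : d x x = 0.
Proof.
apply/eqP; rewrite eq_le (le_trans (term_ge0 x x 0))// andbT.
by apply: d_le => n; rewrite /term subrr normr0 mul0r.
Qed.

Let d_eq0 x y : d x y = 0 -> x = y.
Proof.
move=> d0; apply: F_inj => n; apply/eqP; rewrite -subr_eq0 -normr_eq0.
have : term x y n <= 0 by rewrite -d0.
by rewrite /term ler_pdivrMr// mul0r normr_le0 normr_eq0.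
Qed.

Let d_sym x y : d x y = d y x.
Proof.
suff txy : term x y = term y x.
  by rewrite /d txy.
by apply/funext => n; rewrite /term distrC.
Qed.

Let d_triangle x y z : d x z <= d x y + d y z.
Proof.
apply: d_le => n; apply: le_trans (lerD (term_le_d x y n) (term_le_d y z n)).
by rewrite /term -mulrDl ler_pM2r ?invr_gt0// ler_distD.
Qed.

(** Continuity controls the finitely many terms with [n < N]; the weights alone bound all later
    ones. *)
Let d_near x e : 0 < e -> \forall y \near x, d x y < e.
Proof.
move=> e0; have e20 : 0 < e / 2 by rewrite divr_gt0.
have near_lt N : \forall y \near x,
    forall n, (n < N)%N -> `|F n x - F n y| < e / 2.
  elim: N => [|N IH]; first by near=> y.
  near=> y => n; rewrite ltnS leq_eqVlt => /predU1P[->|].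
    by near: y; move/cvgrPdist_lt : (@cF N x); exact.
  by move: n; near: y.
have [N _ /(_ N (leqnn _)) Ne] := near_infty_natSinv_lt (PosNum e20).
apply: filterS (near_lt N) => y Hy.
(* A strict bound on every term gives only a weak bound on the supremum, hence the margin
   [e / 2]. *)
apply: (@le_lt_trans _ _ (e / 2)); last first.
  by rewrite ltr_pdivrMr// ltr_pMr// ltr1n.
apply: d_le => n; have [nN|Nn] := ltnP n N.
  apply: le_trans (ltW (Hy _ nN)).
  by rewrite /term ler_pdivrMr// ler_peMr// ler1n.
apply: le_trans (ltW Ne); apply: le_trans (term_le _ _ _) _.
by rewrite lef_pV2 ?posrE// ler_nat.
Unshelve. all: by end_near. Qed.

Let d_continuous x : continuous (d x).
Proof.
move=> y; apply/cvgrPdist_lt => e e0; near=> z.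
have dyz : d y z < e by near: z; exact: d_near.
have := d_triangle x y z; have := d_triangle x z y.
by rewrite (d_sym z y) ltr_norml => ? ?; apply/andP; split; lra.
Unshelve. all: by end_near. Qed.

(** For [x] in an open [U], the function [d x] attains its minimum on the compact complement of [U];
    this minimum is positive and serves as the radius. *)
Lemma compact_separating_metrizable : compact [set: T] -> metrizable R T.
Proof.
move=> cT; exists d; split => // U; split=> [oU x Ux|ballU]; last first.
  rewrite openE => x /ballU[e e0 eU]; apply: filterS eU _; exact: d_near.
have cUc : compact (~` U).
  by apply: (subclosed_compact _ cT) => //; exact: open_closedC.
have [U0|/set0P U0] := eqVneq (~` U) set0.
  by exists 1 => // y _; apply: contrapT => nUy; rewrite -[False]/(set0 y) -U0.
have [c] := compact_EVT_min U0 cUc (continuous_subspaceT (@d_continuous x)).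
rewrite inE => nUc minc; exists (d x c).
  rewrite lt_neqAle (le_trans (term_ge0 x c 0))// andbT eq_sym.
  by apply/eqP => /d_eq0 xc; apply: nUc; rewrite -xc.
move=> y /= dy; apply: contrapT => nUy.
by have := minc y; rewrite inE leNgt dy => /(_ nUy).
Qed.

End separating_family.

(** * Passage to subspaces *)

Lemma set_type_metrizable (R : realType) (T : topologicalType) (A : set T) :
  metrizable R T -> metrizable R A.
Proof.
move=> [d [dxx d0 dC dD dU]]; exists (fun x y => d (val x) (val y)).
split => // [x y /d0/val_inj//|U]; split.
  move=> [V oV <-] x /= Vx; have [e e0 eV] := (dU V).1 oV _ Vx.
  by exists e => // y /=; exact: eV.
move=> ballU.
(* The largest open set of [T] with trace inside [U]; it reaches every point of [U] because it
   contains a ball of [T] around each of them. *)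
exists (\bigcup_(V in [set V | open V /\ set_val @^-1` V `<=` U]) V).
  by apply: bigcup_open => V [].
rewrite eqEsubset; split => [x [V [_ VU] Vx]|x Ux]; first exact: VU.
have [e e0 eU] := ballU x Ux.
exists [set y | d (val x) y < e]; last by rewrite /= dxx.
split; last by move=> y /=; exact: eU.
apply/dU => y /= xye; exists (e - d (val x) y); first by rewrite subr_gt0.
by move=> z /=; rewrite ltrBrDl; apply: le_lt_trans; exact: dD.
Qed.

(** A filter on the subspace is pushed forward to [T]; its cluster point lies in [K], hence in [A],
    and so lifts back. *)
Lemma compact_set_val_preimage (T : topologicalType) (A K : set T) :
  compact K -> K `<=` A -> compact (set_val @^-1` K : set A).
Proof.
move=> cK KA F FF FK.
have [x [Kx clx]] := cK (set_val @ F) (fmap_proper_filter _ FF) FK.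
exists (exist _ x (mem_set (KA _ Kx))); split => //.
move=> P Q FP [_ [[V oV <-] Vx VQ]].
have [_ [[p Pp <-] Vp]] : ((set_val : A -> T) @` P) `&` V !=set0.
  apply: clx; first exact: filterS (@preimage_image _ _ set_val P) FP.
  exact: open_nbhs_nbhs.
by exists p; split => //; exact: VQ.
Qed.

(** A compact Hausdorff space is regular, so each point of [A] has a neighbourhood whose closure is
    compact and stays inside [A]. *)
Lemma open_set_type_locally_compact (T : topologicalType) (A : set T) :
  hausdorff_space T -> compact [set: T] -> open A ->
  locally_compact [set: A].
Proof.
move=> hT cT oA x _.
have nA : nbhs (val x) A by apply: open_nbhs_nbhs; split => //; exact: set_valP.
have [V nV VA] := @compact_regular _ (val x) _ hT cT filterT _ nA.
exists (set_val @^-1` closure V).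
  have : nbhs x (set_val @^-1` V) by exact: initial_continuous nV.
  by rewrite withinET; apply: filterS => y;
  exact: (@subset_closure _ V (val y)).
have cV : compact (closure V).
  by apply: (subclosed_compact _ cT) => //; exact: closed_closure.
split; first exact: compact_set_val_preimage.
by apply: preimage_closed (@closed_closure _ V) => ? _; exact: initial_continuous.
Qed.

(** * Functions vanishing at infinity on a one-point compactification *)

Section gap.
Context {R : realType} {X : metricType R}.
Implicit Types (U : set X) (x y : X).

(* The distance to the complement of [U], capped at 1 so that the infimum is
   over a nonempty set when [U] is the whole space. *)
Definition gap U x : R := inf (1 |` (mdist x @` ~` U)).

Let dist_lb U x : lbound (1 |` (mdist x @` ~` U)) 0.
Proof. by move=> _ [->|[y _ <-]]//; exact: mdist_ge0. Qed.

Let gap_le U x r : (1 |` (mdist x @` ~` U)) r -> gap U x <= r.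
Proof. by apply: ge_inf; exists 0. Qed.

Let le_gap U x r : lbound (1 |` (mdist x @` ~` U)) r -> r <= gap U x.
Proof. by apply: lb_le_inf; exists 1; left. Qed.

Lemma gap01 U x : 0 <= gap U x <= 1.
Proof. by rewrite le_gap//= gap_le//; left. Qed.

Lemma gap_eq0 U x : ~ U x -> gap U x = 0.
Proof.
move=> nUx; apply/eqP; rewrite eq_le (andP (gap01 U x)).1 andbT.
by apply: gap_le; right; exists x; rewrite ?mdistxx.
Qed.

(** If [U] contains the ball of radius [e] around [x], then [Num.min 1 e] is a lower bound of the
    set defining [gap U x]. *)
Lemma gap_gt0 U x : open U -> U x -> 0 < gap U x.
Proof.
move=> oU Ux; have /nbhs_ballP[e /= e0] : nbhs x U by exact: open_nbhs_nbhs.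
rewrite ballEmdist => eU; apply: (@lt_le_trans _ _ (Num.min 1 e)).
  by rewrite lt_min ltr01.
apply: le_gap => _ [->|[y nUy <-]]; rewrite ge_min ?lexx//.
by rewrite (leNgt e); apply/orP; right; apply/negP => /eU.
Qed.

Let gap_lipschitz U x y : gap U x <= gap U y + mdist x y.
Proof.
rewrite -lerBlDr; apply: le_gap => _ [->|[z nUz <-]]; rewrite lerBlDr.
  by rewrite (le_trans (andP (gap01 U x)).2)// lerDl mdist_ge0.
apply: (@le_trans _ _ (mdist x z)); first by apply: gap_le; right; exists z.
by rewrite addrC; exact: metric_triangle.
Qed.

Lemma gap_continuous U : continuous (gap U).
Proof.
move=> x; apply/cvgrPdist_lt => e e0; near=> y.
have xy : mdist x y < e.
  suff : ball x e y by rewrite ballEmdist.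
  by near: y; exact: nbhsx_ballx.
have := gap_lipschitz U x y; have := gap_lipschitz U y x.
by rewrite (metric_sym y x) ltr_norml => ? ?; apply/andP; split; lra.
Unshelve. all: by end_near. Qed.

(** Continuity at [None] holds because the function is 0 off the closed compact set [closure U],
    that is, on a neighbourhood of infinity. *)
Lemma gap_infty_continuous U : compact (closure U) ->
  continuous (oapp (gap U) 0 : one_point_compactification X -> R).
Proof.
move=> cU [x|]; first exact: gap_continuous.
move=> V /nbhs_singleton /= V0; exists (closure U).
  by split => //; exact: closed_closure.
move=> _ [[y /= ncUy <-]|->] //=.
by rewrite gap_eq0// => /subset_closure.
Qed.

End gap.

Lemma separating_family_compactification (R : realType) (X : metricType R) :
  @second_countable X -> locally_compact [set: X] ->
  exists h : nat -> one_point_compactification X -> R,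
    [/\ forall i, continuous (h i), forall i x, 0 <= h i x <= 1,
        forall i, h i None = 0 &
        forall x y, (forall i, h i x = h i y) -> x = y].
Proof.
move=> [B /countable_injP[f f_inj] [Bo Bnbhs]] lcX.
pose U i : set X := xget set0 [set V | [/\ B V, f V = i & compact (closure V)]].
have UE V : B V -> compact (closure V) -> U (f V) = V.
  move=> BV cV; rewrite /U; case: xgetP => [V' -> [BV' fV' _]|/(_ V)[]//].
  by apply: f_inj; rewrite ?inE.
have cU i : compact (closure (U i)).
  by rewrite /U; case: xgetP => [V -> []//|_]; rewrite closure0; exact: compact0.
have Uo i : open (U i).
  by rewrite /U; case: xgetP => [V -> [/Bo]//|_]; exact: open0.
have Unbhs x V : nbhs x V -> exists2 i, U i x & U i `<=` V.
  move=> nV; have [K nK [cK clK]] := lcX x I; rewrite withinET in nK.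
  have [W [BW Wx] WKV] := Bnbhs x _ (filterI nK nV).
  have cW : compact (closure W).
    apply: (subclosed_compact (@closed_closure _ W) cK).
    by apply: subset_trans clK; apply: closure_subset => z /WKV[].
  by exists (f W); rewrite UE// => z /WKV[].
pose h i : one_point_compactification X -> R := oapp (gap (U i)) 0.
(* This separates the finite points from infinity, where every [h i] is 0. *)
have hN x : ~ forall i, h i (Some x) = 0.
  have [i Uix _] := Unbhs x _ filterT.
  by move=> /(_ i) /eqP; rewrite gt_eqF//= gap_gt0.
exists h; split => //.
- by move=> i; exact: gap_infty_continuous.
- by move=> i [x|]/=; [exact: gap01|rewrite lexx ler01].
- move=> [x|] [y|] // hxy.
  2: by case: (hN x).
  2: by case: (hN y) => i; rewrite -hxy.
  congr Some; apply: contrapT => xy.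
  have [i Uix Uiy] : exists2 i, U i x & ~ U i y.
    have [A /= [nA nAy]] : exists A : set X, nbhs x A /\ ~ A y.
      exists (~` [set y]); split; last by move/(_ erefl).
      apply: open_nbhs_nbhs; split => //; apply: closed_openC.
      exact/accessible_closed_set1/hausdorff_accessible/metric_hausdorff.
    have [i Uix UA] := Unbhs x A nA; by exists i => // /UA.
  by have /eqP := hxy i; rewrite /h/= (gap_eq0 Uiy) gt_eqF// gap_gt0.
Qed.

(** * Padding as a section of the quotient map *)

Lemma Some_finite_part (T : Type) (o : option T) (h : isSome o) :
  Some (finite_part h) = o.
Proof. by case: o h. Qed.

Section quotient_map.
Variable X : nat -> Type.
Local Notation A := (prod_topology (fun n => one_point_compactification (X n))).

Lemma pad_truncate (a : A) m (hs : forall i : 'I_m, isSome (a i)) n :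
  pad (truncate hs) n = if (n < m)%N then a n else None.
Proof.
case: m hs => [//|k] hs; case: ltnP => [nk|kn]; last exact: pad_finN.
by rewrite (pad_fin _ (Ordinal nk)) Some_finite_part.
Qed.

(** The bound on [i] is strict, so [n] may be the first infinite index of [a], where both sides are
    [None]. *)
Lemma pad_Q (a : A) n :
  (forall i, (i < n)%N -> isSome (a i)) -> pad (Q a) n = a n.
Proof.
move=> an; rewrite /Q; case: pselect => [h|h].
  rewrite pad_truncate; case: ex_minnP => m am _; case: ltnP => // mn.
  have -> : n = m by apply/eqP; rewrite eqn_leq mn leqNgt (contraNN (an m) am).
  by case: (a m) am.
exact: Some_finite_part.
Qed.

Lemma pad_after (w : W0 X) i n :
  (i <= n)%N -> ~~ isSome (pad w i) -> pad w n = None.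
Proof.
case: w => [//|k x|//] le_in.
have [lt_ik|lt_ki] := ltnP i k.+1; first by rewrite (pad_fin x (Ordinal lt_ik)).
by move=> _; exact/pad_finN/(leq_trans lt_ki).
Qed.

End quotient_map.

(** * Products of functions of the coordinates *)

Section monomials.
Context {R : realType} {X : nat -> topologicalType}.
Local Notation opc n := (one_point_compactification (X n)).
Local Notation A := (prod_topology (fun n => opc n)).
Variable h : forall n, nat -> opc n -> R.
Arguments h : clear implicits.
Hypothesis h0 : forall n i, h n i None = 0.

(** The sequence [s] selects one function for each of the first [size s] coordinates, which makes
    the family countable. *)
Definition monomial (s : seq nat) (a : A) : R :=
  \prod_(j < size s) h j (nth 0%N s j) (a j).

(** This is invariance on the fibers of [Q]. Either the first [size s] coordinates of [a] are finite
    and padding preserves them, or [a] and [pad (Q a)] are both infinite at the first infinite index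
    of [a], and both products contain a zero factor. *)
Lemma monomial_pad_Q s a : monomial s (pad (Q a)) = monomial s a.
Proof.
have [/forallP sa|] := boolP [forall j : 'I_(size s), isSome (a j)].
  apply: eq_bigr => j _; rewrite pad_Q// => i ij.
  exact: (sa (Ordinal (ltn_trans ij (ltn_ord j)))).
rewrite negb_forall => /existsP[j0 aj0].
have ex : exists n, ~~ isSome (a n) by exists j0.
have [m am min_m] := ex_minnP ex.
have ms : (m < size s)%N by apply: leq_ltn_trans (min_m _ aj0) _.
have am0 : a m = None by case: (a m) am.
have pm0 : pad (Q a) m = None.
  by rewrite pad_Q// => i; rewrite ltnNge; apply: contraNT => /min_m.
have mon0 b : b m = None -> monomial s b = 0.
  by move=> bm0; rewrite /monomial (bigD1 (Ordinal ms))//= bm0 h0 mul0r.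
by rewrite !mon0.
Qed.

Lemma monomial_continuous s : (forall n i, continuous (h n i)) ->
  continuous (monomial s).
Proof.
move=> ch; apply: (@continuous_big R _ *%R 1 xpredT _ A) => [|j _].
  exact: mul_continuous.
move=> a.
by apply: continuous_comp (@proj_continuous _ _ (j : nat) a) (ch _ _ _).
Qed.

Lemma monomial01 s a : (forall n i x, 0 <= h n i x <= 1) ->
  0 <= monomial s a <= 1.
Proof.
move=> h01; rewrite prodr_ge0 ?prodr_ile1// => j _;
  by case/andP: (h01 j (nth 0%N s j) (a j)).
Qed.

Lemma monomial_rcons s k a :
  monomial (rcons s k) a = monomial s a * h (size s) k (a (size s)).
Proof.
rewrite /monomial size_rcons big_ord_recr /= nth_rcons ltnn eqxx.
by congr (_ * _); apply: eq_bigr => j _; rewrite nth_rcons ltn_ord.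
Qed.

(** The padded coordinates are recovered one at a time, by appending one more factor to a monomial
    that does not vanish at [w]. *)
Lemma monomial_inj (w w' : W0 X) :
  (forall n x y, (forall i, h n i x = h n i y) -> x = y) ->
  (forall s, monomial s (pad w) = monomial s (pad w')) -> w = w'.
Proof.
move=> h_inj ww'; suff pw : pad w = pad w' by rewrite -(padK w) pw padK.
apply: functional_extensionality_dep => n.
(* The nonvanishing monomial is what allows cancelling the first [m] factors. *)
suff H m : (forall j, (j < m)%N -> pad w j = pad w' j) /\
   ((forall j, (j < m)%N -> isSome (pad w j)) ->
    exists s, size s = m /\ monomial s (pad w) != 0).
  by have [/(_ n (ltnSn n))] := H n.+1.
elim: m => [|m [IH1 IH2]].
  by split=> // _; exists [::]; rewrite /monomial big_ord0.
have Em : pad w m = pad w' m.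
  (* If an earlier coordinate is infinite, both paddings are infinite from there on. *)
  have [[j [jm wj]]|Hs] := pselect (exists j, (j < m)%N /\ ~~ isSome (pad w j)).
    rewrite (pad_after (ltnW jm) wj); apply/esym/(pad_after (ltnW jm)).
    by rewrite -IH1.
  have {IH2} [|s [ss s0]] := IH2.
    by move=> j jm; apply: contra_notT Hs => wj; exists j.
  apply: h_inj => k; have := ww' (rcons s k); rewrite !monomial_rcons -ww' ss.
  exact: mulfI.
split=> [j|Hs].
  by rewrite ltnS leq_eqVlt => /predU1P[->//|]; exact: IH1.
have {IH2} [|s [ss s0]] := IH2.
  by move=> j jm; apply: Hs; rewrite (ltn_trans jm).
have [k hk] : exists k, h m k (pad w m) != 0.
  apply: contrapT => nk; have := Hs m (ltnSn m).
  (* If all [h m k] vanished at [pad w m], that coordinate would be infinite, against [Hs]. *)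
  rewrite (h_inj m (pad w m) None)// => k; rewrite h0.
  by apply: contrapT => /eqP hk; apply: nk; exists k.
by exists (rcons s k); rewrite size_rcons ss monomial_rcons mulf_neq0// ss.
Qed.

End monomials.

(** * Compactness of the quotient and conclusion *)

Lemma compact_W0 (X : nat -> topologicalType) : compact [set: W0_space X].
Proof.
have cA : compact
    [set: prod_topology (fun n => one_point_compactification (X n))].
  have := tychonoff (fun n => @one_point_compactification_compact (X n)).
  by congr compact; apply/seteqP; split.
have -> : [set: W0_space X] = \pi_(W0_space X)%qT @` setT.
  by apply/seteqP; split => // w _; exists (repr w) => //; exact: reprK.
by apply: continuous_compact cA; exact/continuous_subspaceT/pi_continuous.
Qed.

Theorem corollary3p3 (R : realType) (X : nat -> metricType R)
  (X_second_countable : forall n, @second_countable (X n))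
  (X_locally_compact : forall n, locally_compact [set: X n]) :
  locally_compact [set: W X] /\ metrizable R (W X).
Proof.
have sep n := separating_family_compactification
  (X_second_countable n) (X_locally_compact n).
pose h n := sval (cid (sep n)); have H n := svalP (cid (sep n)).
have ch n i : continuous (h n i) by have [c _ _ _] := H n; exact: c.
have h01 n i x : 0 <= h n i x <= 1 by have [_ + _ _] := H n; exact.
have h0 n i : h n i None = 0 by have [_ _ + _] := H n; exact.
have h_inj n x y : (forall i, h n i x = h n i y) -> x = y.
  by have [_ _ _] := H n; exact.
(* Finite sequences are enumerated by their codes; a number that codes none gives the empty
   sequence, whose monomial is the constant 1. *)
pose F n (w : W0_space X) := monomial h (odflt [::] (unpickle n)) (pad w).
have cF n : continuous (F n).
  (* Continuity on the quotient is continuity after composing with [Q], and that composite is the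
     monomial itself. *)
  apply/quotient_continuous; rewrite pi.unlock.
  rewrite (_ : _ \o _ = monomial h (odflt [::] (unpickle n))).
    exact: monomial_continuous.
  by apply/funext => a /=; exact: monomial_pad_Q.
have F_inj w w' : (forall n, F n w = F n w') -> w = w'.
  move=> ww'; apply: (monomial_inj h0 h_inj) => s.
  by have := ww' (pickle s); rewrite /F pickleK.
have hW := separating_hausdorff cF F_inj.
split.
  apply: open_set_type_locally_compact => //; first exact: compact_W0.
  (* [W X] is open, being the complement of a point in a Hausdorff space. *)
  by apply: closed_openC; exact/accessible_closed_set1/hausdorff_accessible.
apply: set_type_metrizable; apply: (compact_separating_metrizable cF F_inj).
  by move=> n w; exact: monomial01.
exact: compact_W0.
Qed.
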